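(* Let $n$ be a positive multiple of $3$. Then there exists an orientation of the $n$-dimensional hypercube $Q_n$ that is $(2,3)$-cordial.
   Context: The $n$-dimensional hypercube $Q_n$ has vertex set $\{0,1\}^n$, two vertices adjacent iff they differ in exactly one coordinate. An oriented hypercube is a digraph obtained by assigning to each edge of $Q_n$ exactly one direction. A labeling $f:V\to\{0,1\}$ is friendly if $-1\le |f^{-1}(0)|-|f^{-1}(1)|\le 1$. For a digraph $D=(V,A)$ and $f:V\to\{0,1\}$, the induced arc labeling is $g:A\to\{1,-1,0\}$, $g(\overrightarrow{uv})=f(v)-f(u)$ for the arc from $u$ to $v$. $D$ is $(2,3)$-cordial if there exists a friendly $f$ such that for all $i,j\in\{1,-1,0\}$, $-1\le |g^{-1}(i)|-|g^{-1}(j)|\le 1$. *)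

(* Defs.v *)
From mathcomp Require Import all_boot all_order all_algebra.

Set Implicit Arguments.
Unset Strict Implicit.
Unset Printing Implicit Defensive.

Import Order.TTheory GRing.Theory Num.Theory.

Local Open Scope ring_scope.

Definition cube (n : nat) : finType := {ffun 'I_n -> bool}.

Definition cube_adj (n : nat) : rel (cube n) :=
  fun u v => #|[set i : 'I_n | u i != v i]| == 1%N.

(* A digraph on V is given by its set of arcs A; (u, v) \in A is the arc from
   u to v. *)
Definition orientation_of (V : finType) (e : rel V) (A : {set V * V}) : Prop :=
  (forall u v : V, (u, v) \in A -> e u v) /\
  (forall u v : V, e u v -> ((u, v) \in A) (+) ((v, u) \in A)).

(* The label set {0, 1} is bool, with false for 0 and true for 1. *)
Definition friendly (V : finType) (f : V -> bool) : Prop :=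
  -1 <= #|[set v | f v == false]|%:Z - #|[set v | f v == true]|%:Z <= 1.

Definition arc_label (V : finType) (f : V -> bool) (a : V * V) : int :=
  (f a.2 : nat)%:Z - (f a.1 : nat)%:Z.

Definition cordial23 (V : finType) (A : {set V * V}) : Prop :=
  exists f : V -> bool, friendly f /\
    forall i j : int, i \in [:: 1; -1; 0] -> j \in [:: 1; -1; 0] ->
      -1 <= #|[set a in A | arc_label f a == i]|%:Z
            - #|[set a in A | arc_label f a == j]|%:Z <= 1.

(* Main.v *)
(** Let [f u] be the sum mod 2 of the coordinates [u i] with [i %% 3 != 2]. It
    is balanced, and an edge in direction [i] is cut by [f] iff [i %% 3 != 2].
    Orient the edges of direction [i] from label 0 to label 1 if [i %% 3 = 0],
    from label 1 to label 0 if [i %% 3 = 1], and arbitrarily otherwise: each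
    arc label is then carried by exactly a third of the directions. *)
Require Import Defs.
From mathcomp Require Import all_boot all_order all_algebra.

Set Implicit Arguments.
Unset Strict Implicit.
Unset Printing Implicit Defensive.

Import Order.TTheory GRing.Theory Num.Theory.

(** [g] preserves [Q] and negates [P] on it, so it swaps the two sets. Applied below to coordinate
    flips. *)
Lemma card_involution_negb (T : finType) (g : T -> T) (P Q : pred T) :
  involutive g -> (forall x, Q (g x) = Q x) ->
  (forall x, Q x -> P (g x) = ~~ P x) ->
  #|[set x | Q x & P x]| = #|[set x | Q x & ~~ P x]|.
Proof.
move=> gK Qg Pg; rewrite -(card_imset _ (can_inj gK)); apply: eq_card => y.
rewrite inE; apply/imsetP/andP => [[x] | [Qy nPy]].
  by rewrite inE => /andP[Qx Px] ->; rewrite Qg Pg ?Px.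
by exists (g y); rewrite ?gK // inE Qg Pg // Qy.
Qed.

Section Cube.

Variable n : nat.
Implicit Types (u v : cube n) (i : 'I_n).

Definition flip i u : cube n := [ffun j => u j (+) (j == i)].

Lemma flipK i : involutive (flip i).
Proof. by move=> u; apply/ffunP=> j; rewrite !ffunE addbK. Qed.

Lemma flip_inj u : injective (flip^~ u).
Proof.
by move=> i j /ffunP/(_ i); rewrite !ffunE eqxx => /addbI/esym/eqP.
Qed.

Lemma cube_adjP u v : reflect (exists i, v = flip i u) (cube_adj u v).
Proof.
apply: (iffP cards1P) => -[i Di]; exists i.
  apply/ffunP=> j; rewrite ffunE; have /setP/(_ j) := Di.
  by rewrite !inE => <-; case: (u j) (v j) => -[].
by apply/setP=> j; rewrite !inE Di ffunE; case: (u j); case: (j == i).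
Qed.

(** An arc is encoded by its tail and its direction: [P (u, i)] means that the edge at [u] in
    direction [i] leaves [u]. *)
Definition directed_arcs (P : pred (cube n * 'I_n)) : {set cube n * cube n} :=
  [set (p.1, flip p.2 p.1) | p in P].

Lemma arc_inj : injective (fun p : cube n * 'I_n => (p.1, flip p.2 p.1)).
Proof. by move=> [u i] [v j] [/= <- /flip_inj <-]. Qed.

Lemma mem_directed_arcs P u i :
  ((u, flip i u) \in directed_arcs P) = P (u, i).
Proof. exact: (mem_imset P (u, i) arc_inj). Qed.

Lemma directed_arcs_orientation P :
  (forall u i, P (flip i u, i) = ~~ P (u, i)) ->
  orientation_of (@cube_adj n) (directed_arcs P).
Proof.
move=> Pflip; split=> u v.
  by case/imsetP=> -[w i] _ [-> ->]; apply/cube_adjP; exists i.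
case/cube_adjP=> i ->; rewrite mem_directed_arcs.
(* The reverse arc is the one leaving [flip i u] in the same direction [i]. *)
by rewrite -{3}(flipK i u) mem_directed_arcs Pflip addbN addbb.
Qed.

(** Flipping along the direction pairs the two ends of each edge, and [P] holds at exactly one of
    them, hence at half of the pairs [(u, i)] with [Q i]. Doubling avoids a division by 2. *)
Lemma card_directed_arcs P (Q : pred 'I_n) :
  (forall u i, P (flip i u, i) = ~~ P (u, i)) ->
  #|[set p | Q p.2 & P p]|.*2 = (2 ^ n * #|[set i | Q i]|)%N.
Proof.
move=> Pflip; pose g (p : cube n * 'I_n) := (flip p.2 p.1, p.2).
have gK : involutive g by case=> u i; rewrite /g /= flipK.
rewrite -addnn {2}(card_involution_negb gK) //; last first.
  by case=> u i _; apply: Pflip.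
have -> : (2 ^ n = #|[set: cube n]|)%N.
  by rewrite cardsT card_ffun card_bool card_ord.
rewrite -cardsX -(cardsID [set p | P p] (setX _ _)).
by congr (_ + _)%N; apply: eq_card => p; rewrite !inE // andbC.
Qed.

Definition parity_label u : bool := \big[addb/false]_(i < n | i %% 3 != 2) u i.

Lemma parity_label_flip i u :
  parity_label (flip i u) = parity_label u (+) (i %% 3 != 2).
Proof.
rewrite /parity_label; under eq_bigr do rewrite ffunE.
rewrite big_split /=; congr (_ (+) _).
case: (boolP (i %% 3 != 2)) => Si; last first.
  by rewrite big1 // => j Sj; apply: contraNF Si => /eqP <-.
by rewrite (bigD1 i) //= eqxx big1 // => j /andP[_ /negPf].
Qed.

Lemma parity_label_friendly : (0 < n)%N -> friendly parity_label.
Proof.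
(* Coordinate 0 enters the parity since [0 %% 3 != 2], so flipping it exchanges the two label
   classes. *)
move=> n_gt0; pose i0 := Ordinal n_gt0.
have H : #|[set v | parity_label v == false]|
       = #|[set v | parity_label v == true]|.
  have := @card_involution_negb _ (flip i0) parity_label predT (flipK i0).
  move=> /(_ (fun=> erefl)) E; transitivity #|[set v | ~~ parity_label v]|.
    by apply: eq_card => v; rewrite !inE eqbF_neg.
  rewrite -[LHS]E => [|v _]; last by rewrite parity_label_flip addbT.
  by apply: eq_card => v; rewrite !inE eqb_id.
by rewrite /friendly H subrr.
Qed.

(** For residue 2 both ends carry the same label, so the coordinate itself selects the tail. *)
Definition tail (p : cube n * 'I_n) : bool :=
  if p.2 %% 3 == 2 then p.1 p.2 else parity_label p.1 == (p.2 %% 3 == 1).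

Lemma tail_flip u i : tail (flip i u, i) = ~~ tail (u, i).
Proof.
rewrite /tail /= parity_label_flip ffunE eqxx.
by case: (i %% 3 == 2); rewrite ?addbT //=; case: parity_label; case: (_ == 1).
Qed.

(** Residue 2 runs past the end of the list and gets the default value 0. *)
Definition direction_label (i : nat) : int := [:: 1; -1]%R`_(i %% 3).

Lemma arc_label_tail u i :
  tail (u, i) -> arc_label parity_label (u, flip i u) = direction_label i.
Proof.
rewrite /tail /arc_label /direction_label /= parity_label_flip.
have: i %% 3 < 3 by rewrite ltn_mod.
by case: (i %% 3) => [|[|[|//]]] _ /=; case: parity_label.
Qed.

Lemma card_arc_label (c : int) :
  #|[set a in directed_arcs tail | arc_label parity_label a == c]|.*2
  = (2 ^ n * #|[set i : 'I_n | direction_label i == c]|)%N.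
Proof.
rewrite -(card_directed_arcs _ tail_flip) -(card_imset _ arc_inj).
congr _.*2; apply: eq_card => a; rewrite inE.
apply/andP/imsetP => [[/imsetP[[u i] Pp ->]] | [[u i]]].
  by rewrite arc_label_tail // => Hc; exists (u, i); rewrite ?inE //= Hc.
rewrite inE /= => /andP[/eqP Hc Pp] ->.
by rewrite mem_directed_arcs arc_label_tail // Hc.
Qed.

End Cube.

(** Each block of three consecutive directions contains every label exactly once. *)
Lemma card_direction_label (m : nat) (c : int) :
  c \in [:: 1; -1; 0]%R ->
  #|[set i : 'I_(m * 3) | direction_label i == c]| = m.
Proof.
move=> c_in; rewrite -sum1dep_card.
rewrite -(big_mkord (fun i => direction_label i == c) (fun=> 1)).
elim: m => [|m IHm]; first by rewrite big_geq.
rewrite mulSn addnC (@big_cat_nat _ _ _ (m * 3)) ?leq_addr //= IHm.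
(* The last block is shifted down to the indices 0, 1, 2; residues mod 3 are unchanged. *)
rewrite -{1}[m * 3]add0n addnC big_addn addKn.
under eq_bigl => i do rewrite /direction_label addnC modnMDl.
rewrite big_mkcond /= !big_nat_recl // big_geq //=.
by move: c_in; rewrite !inE => /or3P[] /eqP ->.
Qed.

Theorem theorem1 (n : nat) (hn : (0 < n)%N) (h3 : (3 %| n)%N) :
  exists A : {set cube n * cube n},
    orientation_of (@cube_adj n) A /\ cordial23 A.
Proof.
case/dvdnP: h3 hn => m -> hn.
exists (directed_arcs (@tail (m * 3))); split.
  exact/directed_arcs_orientation/tail_flip.
exists (@parity_label (m * 3)); split; first exact: parity_label_friendly.
move=> i j Hi Hj.
suff -> : #|[set a in directed_arcs (@tail (m * 3))
               | arc_label (@parity_label _) a == i]|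
        = #|[set a in directed_arcs (@tail (m * 3))
               | arc_label (@parity_label _) a == j]| by rewrite subrr.
(* Both doubled counts equal [2 ^ (m * 3) * m]. *)
by apply: double_inj; rewrite !card_arc_label !card_direction_label.
Qed.
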